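(* Let $X$ be a real Banach space, let $f: X \to \mathbb{R}\cup\{+\infty\}$ be a proper convex function, let $\bar{x}\in\operatorname{dom}f$, $r>0$ and $\ell\geq 0$. Then the following three statements are equivalent: (i) $f$ is $\ell$-Lipschitz on $\operatorname{dom}f\cap B(\bar{x};r)$; (a) $f$ is calm at every point of $\operatorname{dom}f\cap B(\bar{x};r)$ with the same modulus $\ell$; (b) $\partial f(x)\cap\ell\mathbb{B}^*\neq\emptyset$ for all $x\in \operatorname{dom}f\cap B(\bar{x};r)$.
   Context: $X^*$ is the continuous dual of $X$ with its dual norm, $\mathbb{B}^*$ is the closed unit ball of $X^*$ (so $\ell\mathbb{B}^*=\{x^*\in X^*:\|x^*\|\le \ell\}$), and $B(x;r)=\{y\in X:\|x-y\|<r\}$. For $f:X\to\mathbb{R}\cup\{+\infty\}$, $\operatorname{dom}f=\{x\in X: f(x)\in\mathbb{R}\}$; $f$ is proper if $\operatorname{dom} f\neq\emptyset$, and convex if its epigraph $\{(x,r)\in X\times\mathbb{R}: f(x)\le r\}$ is convex. For a nonempty set $S\subset X$, $f$ is $\ell$-Lipschitz on $S$ if $f$ is finite on $S$ and $|f(x)-f(y)|\le \ell\|x-y\|$ for all $x,y\in S$. $f$ is calm at $u\in\operatorname{dom}f$ with modulus $\ell\ge 0$ if there is a neighborhood $V$ of $u$ in $X$ such that $f(x)\ge f(u)-\ell\|x-u\|$ for all $x\in V$. The subdifferential of $f$ at $x$ with $f(x)$ finite is $\partial f(x)=\{x^*\in X^*: f(y)-f(x)\ge\langle x^*,y-x\rangle\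 \forall y\in X\}$. *)

(* Defs.v *)
From HB Require Import structures.
From mathcomp Require Import all_boot all_order all_algebra.
From mathcomp Require Import all_classical all_reals all_analysis.
Import Order.TTheory GRing.Theory Num.Theory.
Import numFieldNormedType.Exports.

Set Implicit Arguments.
Unset Strict Implicit.
Unset Printing Implicit Defensive.

Local Open Scope classical_set_scope.
Local Open Scope ring_scope.

Section dual.
Context {R : realType} (X : normedModType R).

Record dual := Dual {
  dual_fun :> {linear X -> R^o};
  dual_continuous : continuous dual_fun
}.

(* The supremum is taken in [\bar R], so that it needs no side condition; it is
   finite because a continuous linear form is bounded on the unit ball. *)
Definition dual_norm (p : dual) : \bar R :=
  ereal_sup [set `|p x|%:E | x in [set x : X | `|x| <= 1]].

Definition dual_ball (l : R) : set dual :=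
  [set p | (dual_norm p <= l%:E)%E].

End dual.

(* A function X -> R U {+oo} is represented by f : X -> \bar R such that
   [never_ninfty f]. *)
Section extended_real_functions.
Context {R : realType} {X : normedModType R}.
Implicit Types (f : X -> \bar R) (S : set X) (l : R).

Definition never_ninfty f := forall x, f x != -oo%E.

Definition edom f : set X := [set x | f x \is a fin_num].

Definition proper_efun f := edom f !=set0.

Definition epigraph f : set (X * R^o) := [set z | (f z.1 <= z.2%:E)%E].

Definition convex_efun f := @convex_set R (X * R^o)%type (epigraph f).

Definition lipschitz_efun_on f l S :=
  S `<=` edom f /\ l.-lipschitz_S (fine \o f : X -> R^o).

Definition calm f u l :=
  [/\ edom f u, 0 <= l &
      \forall x \near u, (f u - (l * `|x - u|)%:E <= f x)%E].

Definition subdifferential f (x : X) : set (dual X) :=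
  [set p | edom f x /\ forall y, ((p (y - x))%:E <= f y - f x)%E].

End extended_real_functions.

(* Main.v *)
Require Import Defs.
From HB Require Import structures.
From mathcomp Require Import all_boot all_order all_algebra.
From mathcomp Require Import all_classical all_reals all_analysis.
From mathcomp Require Import ring lra.
Import Order.TTheory GRing.Theory Num.Theory.
Import numFieldNormedType.Exports.
Local Open Scope classical_set_scope.
Local Open Scope ring_scope.

(** Everything rests on one remark: for a convex function, calmness at [x] is
    a global property.  The lower bound [f x - l * `|y - x|] holds for [y] near
    [x], and both sides of the inequality can be compared along the segment
    from [x] to an arbitrary point, on which [f] lies below its chord
    ([calm_global]).

    Using the global bound at [x] and at [y] gives the two halves of
    [`|f x - f y| <= l * `|x - y|], so calmness on a set implies the
    Lipschitz property there; the converse holds because the ball is open and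
    [f] is [+oo] off its domain.

    A subgradient in the ball of radius [l] minorizes [f] by
    [f x - l * `|y - x|], which is calmness.  Conversely, the global bound says
    that the convex cone generated by the epigraph of [f], translated so that
    [(x, f x)] becomes the origin, lies above the graph of
    [h |-> - l * `|h|].  By the Hahn-Banach theorem some linear form lies
    between the two ([sandwich_cone]): being below the cone makes it a
    subgradient, and being dominated by [l * `|_|] bounds its norm by [l].

    The Hahn-Banach theorem is obtained by taking, by Zorn's lemma, a minimal
    element among the sublinear functionals below the given one, and showing
    that minimality forces linearity.  This has no partially defined functional
    to extend, and a single construction, the greatest sublinear functional
    below both a sublinear functional and a cone ([sublinear_below_cone]),
    serves twice: to insert a functional below the epigraph, and to show that
    a minimal functional is odd. *)

(** * Sublinear functionals and the Hahn-Banach sandwich *)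

Section sublinear.
Context {R : realType} {V : lmodType R}.
Implicit Types (p N : V -> R) (C : set (V * R)) (x y k : V) (s t a : R).

(** The inequality in the second clause is an equality, as one sees by applying
    it to [t^-1] as well ([sublinearZ]); the one-sided form is what infima
    satisfy directly. *)
Definition sublinear p :=
  (forall x y, p (x + y) <= p x + p y) /\
  (forall t x, 0 < t -> p (t *: x) <= t * p x).

Definition convex_cone C :=
  (forall k a k' a', C (k, a) -> C (k', a') -> C (k + k', a + a')) /\
  (forall t k a, 0 < t -> C (k, a) -> C (t *: k, t * a)).

Lemma sublinearZ p t x : sublinear p -> 0 < t -> p (t *: x) = t * p x.
Proof.
move=> [_ pZ] t0; apply/eqP; rewrite eq_le pZ//=.
have := pZ t^-1 (t *: x); rewrite invr_gt0 => /(_ t0).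
by rewrite scalerA mulVf ?gt_eqF// scale1r ler_pdivlMl.
Qed.

Lemma sublinear0 p : sublinear p -> p 0 = 0.
Proof.
move=> ps; have := sublinearZ p 2 0 ps; rewrite scaler0 => /(_ ltac:(by [])).
lra.
Qed.

Lemma sublinear_geN p x : sublinear p -> - p (- x) <= p x.
Proof.
move=> ps; have := ps.1 x (- x); rewrite subrr sublinear0//; lra.
Qed.

(** The lower boundary of a convex cone in [V * R] with nonempty fibers bounded
    below is sublinear.  The cone is given by its fibers [E x], and only needs
    to be closed under the operations up to decreasing the second coordinate;
    that weakening lets the same lemma treat chains of functionals, where a sum
    of values of two functionals is bounded by a value of the smaller one. *)
Lemma sublinear_inf (E : V -> set R) (m : V -> R) :
  (forall x, E x !=set0) -> (forall x, lbound (E x) (m x)) ->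
  (forall x y a b, E x a -> E y b -> exists2 c, E (x + y) c & c <= a + b) ->
  (forall t x a, 0 < t -> E x a -> exists2 c, E (t *: x) c & c <= t * a) ->
  sublinear (fun x => inf (E x)).
Proof.
move=> E0 Em ED EZ.
have infle x a : E x a -> inf (E x) <= a by apply: ge_inf; exists (m x).
split=> [x y|t x t0].
  rewrite -lerBlDr; apply: lb_le_inf => // a Ea.
  rewrite lerBlDr -lerBlDl; apply: lb_le_inf => // b Eb.
  by rewrite lerBlDl; have [c /infle Ec] := ED _ _ _ _ Ea Eb; exact: le_trans.
rewrite -ler_pdivrMl//; apply: lb_le_inf => // a Ea; rewrite ler_pdivrMl//.
by have [c /infle Ec] := EZ _ _ _ t0 Ea; exact: le_trans.
Qed.

(** The functional is the infimal convolution of [N] with the lower boundary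
    of [C], namely [x |-> inf (a + N (x - k))] over [(k, a)] in [C].  The
    compatibility hypothesis makes the infimum finite; the points [(0, 0)] and
    [(x, a)] of [C] give the two upper bounds. *)
Lemma sublinear_below_cone N C : sublinear N -> convex_cone C -> C (0, 0) ->
  (forall k a, C (k, a) -> - N (- k) <= a) ->
  exists p, [/\ sublinear p, forall x, p x <= N x &
                forall k a, C (k, a) -> p k <= a].
Proof.
move=> Ns [CD CZ] C0 NC.
pose E x := [set z.2 + N (x - z.1) | z in C].
have Elb x : lbound (E x) (- N (- x)).
  move=> _ [[k a] /= /NC ka <-].
  have := Ns.1 (- x) (x - k); rewrite addKr; lra.
have infle x a : E x a -> inf (E x) <= a by apply: ge_inf; eexists; exact: Elb.
exists (fun x => inf (E x)); split.
- apply: (@sublinear_inf _ (fun x => - N (- x))) => //.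
  + by move=> x; exists (0 + N (x - 0)), (0, 0).
  + move=> x y _ _ [[k a] /= Ca <-] [[k' a'] /= Ca' <-].
    exists ((a + a') + N (x + y - (k + k'))).
      by exists (k + k', a + a') => //; exact: CD.
    by rewrite addrACA lerD2l opprD addrACA; exact: Ns.1.
  + move=> t x _ t0 [[k a] /= Ca <-].
    exists (t * a + N (t *: x - t *: k)); first by exists (t *: k, t * a); auto.
    by rewrite mulrDr lerD2l -scalerBr; exact: Ns.2.
- by move=> x; apply: infle; exists (0, 0) => //=; rewrite add0r subr0.
- move=> k a Ca; apply: infle; exists (k, a) => //=.
  by rewrite subrr sublinear0// addr0.
Qed.

(** A chain of sublinear functionals below [N] is bounded below pointwise by
    [- N (- x)], so its pointwise infimum is again one, and Zorn's lemma
    applies. *)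
Lemma minimal_sublinear N : sublinear N ->
  exists p, [/\ sublinear p, forall x, p x <= N x &
    forall p', sublinear p' -> (forall x, p' x <= p x) ->
               forall x, p x <= p' x].
Proof.
move=> Ns.
pose T := {p : V -> R | sublinear p /\ forall x, p x <= N x}.
pose ge (p p' : T) := `[< forall x, sval p' x <= sval p x >].
have /(ZL_preorder (exist _ N (conj Ns (fun x => lexx _)) : T)) :
  forall u : T, ge u u by move=> u; apply/asboolP.
case.
- move=> u v w /asboolP pq /asboolP qs; apply/asboolP => x.
  exact: le_trans (qs x) (pq x).
- move=> A Atot; have [[g0 Ag0]|/set0P/negP/negPn/eqP ->] := pselect (A !=set0);
    last by exists (exist _ N (conj Ns (fun x => lexx _))).
  pose E x := [set sval g x | g in A].
  have Elb x : lbound (E x) (- N (- x)).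
    move=> _ [g _ <-]; have [gs gN] := svalP g.
    by rewrite (le_trans _ (sublinear_geN _ x gs))// lerN2.
  have infle x a : E x a -> inf (E x) <= a by apply: ge_inf; eexists; exact: Elb.
  have infs : sublinear (fun x => inf (E x)).
    apply: (@sublinear_inf _ (fun x => - N (- x))) => //.
    + by move=> x; exists (sval g0 x), g0.
    + move=> x y _ _ [g Ag <-] [h Ah <-].
      have [/asboolP gh|/asboolP hg] := Atot _ _ Ag Ah.
        exists (sval h (x + y)); first by exists h.
        by rewrite (le_trans ((svalP h).1.1 _ _))// lerD2r.
      exists (sval g (x + y)); first by exists g.
      by rewrite (le_trans ((svalP g).1.1 _ _))// lerD2l.
    + move=> t x _ t0 [g Ag <-]; exists (sval g (t *: x)); first by exists g.
      exact: (svalP g).1.2.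
  have infN x : inf (E x) <= N x.
    by rewrite (le_trans _ ((svalP g0).2 x))// infle//; exists g0.
  exists (exist _ (fun x => inf (E x)) (conj infs infN) : T) => g Ag; apply/asboolP => x /=.
  by apply: infle; exists g.
- move=> [p [ps pN]] pmin; exists p; split => // p' p's p'p.
  have p'N x : p' x <= N x by exact: le_trans (pN x).
  have /asboolP := pmin (exist _ p' (conj p's p'N) : T) ltac:(exact/asboolP).
  exact.
Qed.

(** The ray generated by [(- y, - p y)] is compatible with [p], so there is a
    sublinear functional below [p] whose value at [- y] is at most [- p y].
    By minimality it is not below [p] strictly, so [p (- y) <= - p y]; the other
    inequality is subadditivity. *)
Lemma minimal_sublinear_odd p : sublinear p ->
  (forall p', sublinear p' -> (forall x, p' x <= p x) ->
              forall x, p x <= p' x) ->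
  forall y, p (- y) = - p y.
Proof.
move=> ps pmin y.
pose C := [set z : V * R | exists2 t, 0 <= t & z = (- (t *: y), - (t * p y))].
have [||k a [t t0 [-> ->]]|p' [p's p'p p'C]] := sublinear_below_cone p C ps.
- split=> [k a k' a'|s k a s0] [t t0 [-> ->]].
    move=> [t' t'0 [-> ->]]; exists (t + t'); first exact: addr_ge0.
    by rewrite scalerDl mulrDl !opprD.
  exists (s * t); first by rewrite mulr_ge0// ltW.
  by rewrite scalerN scalerA mulrN mulrA.
- by exists 0 => //; rewrite scale0r mul0r !oppr0.
- rewrite opprK lerN2; move: t0; rewrite le_eqVlt => /predU1P[<-|t0].
    by rewrite scale0r mul0r sublinear0.
  by rewrite sublinearZ.
apply/eqP; rewrite eq_le; apply/andP; split; last first.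
  by rewrite lerNl; exact: sublinear_geN.
rewrite (le_trans (pmin _ p's p'p _))//; apply: p'C.
by exists 1; rewrite ?scale1r ?mul1r.
Qed.

(** Hahn-Banach: a sublinear functional below both [N] and [C], made minimal, is
    odd, and an odd sublinear functional is linear because its inequalities
    hold in both directions. *)
Lemma sandwich_cone N C : sublinear N -> convex_cone C -> C (0, 0) ->
  (forall k a, C (k, a) -> - N (- k) <= a) ->
  exists p : {linear V -> R^o}, (forall x, p x <= N x) /\
    (forall k a, C (k, a) -> p k <= a).
Proof.
move=> Ns Cc C0 NC.
have [q [qs qN qC]] := sublinear_below_cone N C Ns Cc C0 NC.
have [p [ps pq pmin]] := minimal_sublinear q qs.
have pN := minimal_sublinear_odd p ps pmin.
have pD x y : p (x + y) = p x + p y.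
  apply/eqP; rewrite eq_le ps.1/=.
  by have := ps.1 (- x) (- y); rewrite -opprD !pN; lra.
have pZ t x : p (t *: x) = t * p x.
  have [t0|t0|->] := ltgtP t 0; last by rewrite scale0r mul0r sublinear0.
    rewrite -[t]opprK scaleNr pN sublinearZ ?oppr_gt0//.
    by rewrite !mulNr.
  exact: sublinearZ.
have plin : linear (p : V -> R^o) by move=> t x y; rewrite pD pZ.
pose pL := GRing.isLinear.Build R V R^o *:%R p plin.
pose P : {linear V -> R^o} := HB.pack (p : V -> R^o) pL.
exists P; split=> [x|k a Ca]; first exact: le_trans (pq x) (qN x).
exact: le_trans (pq k) (qC _ _ Ca).
Qed.

End sublinear.

(** * Convex functions, calmness and subgradients *)

Section convex_functions.
Context {R : realType} {X : normedModType R}.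
Implicit Types (f : X -> \bar R) (x y : X) (l a b s : R).

Lemma convex_efun_le f x y a b s : convex_efun f -> 0 <= s <= 1 ->
  (f x <= a%:E -> f y <= b%:E ->
   f (s *: x + (1 - s) *: y)%R <= (s * a + (1 - s) * b)%:E)%E.
Proof.
move=> fc s01 fa fb.
have /= := fc (x, a) (y, b) (Itv01 (andP s01).1 (andP s01).2).
by rewrite !inE; exact.
Qed.

Lemma edomE f x : edom f x -> f x = (fine (f x))%:E.
Proof. by move=> fx; rewrite fineK. Qed.

(** The point [z] at proportion [s] of the segment from [x] to [y] is close to
    [x] for small [s]; there calmness gives [f x - l * s * `|y - x| <= f z],
    while convexity gives [f z <= s * b + (1 - s) * f x].  The terms in [f x]
    combine to [s * f x], and dividing by [s] yields the bound at [y]. *)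
Lemma calm_global f x y l b : convex_efun f -> calm f x l ->
  (f y <= b%:E)%E -> fine (f x) - l * `|y - x| <= b.
Proof.
move=> fc [fx l0 /nbhs_ballP[e /= e0 ecalm]] fyb.
(* This [s] satisfies both [s <= 1] and [s * d < e], even when [d = 0]. *)
pose d := `|y - x|; pose s := e / (e + d).
have d0 : 0 <= d by exact: normr_ge0.
have ed0 : 0 < e + d by rewrite ltr_pwDl.
have s0 : 0 < s by rewrite divr_gt0.
have s1 : s <= 1 by rewrite ler_pdivrMr// mul1r lerDl.
pose z := s *: y + (1 - s) *: x.
have zx : `|z - x| = s * d.
  rewrite -(gtr0_norm s0) -normrZ; congr `|_|.
  by rewrite /z scalerBl scale1r scalerBr addrCA addrC addrK.
have : (f x - (l * `|z - x|)%:E <= f z)%E.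
  apply: ecalm; rewrite -ball_normE /= distrC zx /s mulrAC ltr_pdivrMr//.
  by rewrite ltr_pM2l// ltrDr.
have : (f z <= (s * b + (1 - s) * fine (f x))%:E)%E.
  apply: convex_efun_le => //; first by rewrite s1 ltW.
  by rewrite -edomE.
move=> /[swap] /le_trans/[apply]; rewrite edomE// zx -EFinB lee_fin /=.
rewrite -/d => h; rewrite -subr_ge0 -(pmulr_rge0 _ s0); lra.
Qed.

Lemma dual_ball_le l (p : dual X) x : dual_ball l p -> `|p x| <= l * `|x|.
Proof.
move=> pl; have [->|x0] := eqVneq x 0; first by rewrite linear0 !normr0 mulr0.
have xgt0 : 0 < `|x| by rewrite normr_gt0.
rewrite -ler_pdivrMr//.
have : (`|p (`|x|^-1 *: x)|%:E <= l%:E)%E.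
  apply: le_trans pl; apply: ereal_sup_ubound; exists (`|x|^-1 *: x) => //=.
  by rewrite normrZ normfV normr_id mulVf ?gt_eqF.
by rewrite lee_fin linearZ /= normrZ normfV normr_id mulrC.
Qed.

(** A one-sided bound suffices, since a linear form is odd; the two-sided bound
    it implies gives both continuity and the estimate of the dual norm. *)
Lemma dominated_dual_ball l (p : {linear X -> R^o}) : 0 <= l ->
  (forall x, p x <= l * `|x|) -> exists2 q : dual X, dual_ball l q & q =1 p.
Proof.
move=> l0 pl.
have pn x : `|p x| <= l * `|x|.
  by rewrite ler_norml pl andbT lerNl -linearN -normrN pl.
have pc : continuous p.
  apply: bounded_linear_continuous; exists l; split; first exact: num_real.
  move=> M lM; have : nbhs (0 : X) (ball 0 1) by exact: nbhsx_ballx.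
  apply: filterS => x; rewrite -ball_normE /= sub0r normrN => /ltW x1.
  by rewrite (le_trans (pn x))// (le_trans _ (ltW lM))// ler_piMr.
exists (Dual pc) => //=; apply: ge_ereal_sup => _ [x /= x1 <-].
by rewrite lee_fin (le_trans (pn x))// ler_piMr.
Qed.

(** The convex cone generated by the epigraph of [f] seen from [(x, f x)]: its
    lower boundary is the directional derivative of [f] at [x], by
    monotonicity of difference quotients. *)
Definition slope_cone f x : set (X * R) :=
  [set z | exists2 t, 0 < t & (f (x + t *: z.1)%R <= (fine (f x) + t * z.2)%:E)%E].

(** Stability under addition is where convexity enters: points of the epigraph
    reached with steps [t] and [t'] are averaged with the weights
    [t' / (t + t')] and [t / (t + t')], which bring both directions to the
    common step [t * t' / (t + t')]. *)
Lemma slope_cone_convex f x : convex_efun f -> edom f x ->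
  convex_cone (slope_cone f x).
Proof.
move=> fc fx; split=> [k a k' a' [t /= t0 ft] [t' /= t'0 ft']|s k a s0 [t /= t0 ft]].
  have tt0 : 0 < t + t' by rewrite addr_gt0.
  have ttN0 : t + t' != 0 by rewrite gt_eqF.
  pose s := t' / (t + t').
  have s01 : 0 <= s <= 1.
    by rewrite ltW ?divr_gt0//= ler_pdivrMr// mul1r lerDr ltW.
  exists (s * t) => /=; first by rewrite mulr_gt0// divr_gt0.
  have st : s * t = (1 - s) * t' by rewrite /s; field.
  have := convex_efun_le f _ _ _ _ s fc s01 ft ft'.
  congr (f _ <= _)%E.
    rewrite !scalerDr !scalerA -st addrACA -scalerDl (addrC s) subrK.
    by rewrite scale1r.
  by congr (_%:E); rewrite mulrDr (mulrA s) mulrDr (mulrA (1 - s)) -st; ring.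
exists (t / s) => /=; first by rewrite divr_gt0.
by rewrite scalerA mulrA divfK ?gt_eqF.
Qed.

(** The global form of calmness says exactly that the slope cone and
    [l * `|_|] satisfy the hypothesis of [sandwich_cone]. *)
Lemma calm_subgradient f x l : convex_efun f -> never_ninfty f -> calm f x l ->
  subdifferential f x `&` dual_ball l !=set0.
Proof.
move=> fc fN cx; have [fx l0 _] := cx.
have Ns : sublinear (fun h : X => l * `|h|).
  split=> [h k|t h t0]; first by rewrite -mulrDr ler_wpM2l// ler_normD.
  by rewrite normrZ gtr0_norm// mulrCA.
have [|k a [t /= t0 ft]|p [pN pC]] :=
    sandwich_cone _ (slope_cone f x) Ns (slope_cone_convex f x fc fx).
- by exists 1 => //=; rewrite scaler0 mulr0 !addr0 -edomE.
- rewrite normrN.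
  have := calm_global f x _ l _ fc cx ft.
  rewrite addrAC subrr add0r normrZ gtr0_norm// => h.
  by rewrite -subr_ge0 -(pmulr_rge0 _ t0); lra.
have [q ql qp] := dominated_dual_ball l p l0 pN.
exists q; split=> //; split=> // y; rewrite qp (edomE f x fx).
have := fN y; case fy : (f y) => [b||]//= _; last by rewrite addye// leey.
rewrite -EFinB lee_fin; apply: pC; exists 1 => //=.
by rewrite scale1r addrC subrK fy lee_fin; lra.
Qed.

Lemma subgradient_calm f x l : 0 <= l ->
  subdifferential f x `&` dual_ball l !=set0 -> calm f x l.
Proof.
move=> l0 [p [[fx pf] pl]]; split=> //; apply: nearW => y.
have := pf y; rewrite (edomE f x fx) leeBrDl//; apply: le_trans.
rewrite -EFinB -EFinD lee_fin lerD2l.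
by have := dual_ball_le l p (y - x) pl; rewrite ler_norml distrC => /andP[].
Qed.

Lemma lipschitz_calm f l (U : set X) x : open U -> 0 <= l -> never_ninfty f ->
  lipschitz_efun_on f l (edom f `&` U) -> (edom f `&` U) x -> calm f x l.
Proof.
move=> Uo l0 fN [_ fl] [fx Ux]; split=> //.
have : nbhs x U by exact: open_nbhs_nbhs.
apply: filterS => y Uy.
have [fy|] := boolP (f y \is a fin_num); last first.
  by have := fN y; case: (f y) => //= _ _; rewrite leey.
rewrite (edomE f x fx) (edomE f y fy) -EFinB lee_fin.
have := fl (x, y) (conj (conj fx Ux) (conj fy Uy)).
by rewrite /self_sub /= distrC ler_norml (distrC x) => /andP[]; lra.
Qed.

(** [calm_global] holds at both points, and the two resulting bounds are the two
    halves of the Lipschitz inequality. *)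
Lemma calm_lipschitz f l (S : set X) : convex_efun f ->
  (forall x, S x -> calm f x l) -> lipschitz_efun_on f l S.
Proof.
move=> fc cf; split=> [x /cf[]//|[x y] /= [Sx Sy]].
have [cx cy] := (cf _ Sx, cf _ Sy).
have [[fx _ _] [fy _ _]] := (cx, cy).
have fE z : edom f z -> (f z <= (fine (f z))%:E)%E by move=> /edomE <-.
have := calm_global f x y l _ fc cx (fE y fy).
have := calm_global f y x l _ fc cy (fE x fx).
by rewrite ler_norml (distrC y x); lra.
Qed.

End convex_functions.

Theorem theorem3p1 (R : realType) (X : completeNormedModType R)
    (f : X -> \bar R) (xbar : X) (r l : R)
    (f_ninfty : never_ninfty f) (f_proper : proper_efun f)
    (f_convex : convex_efun f)
    (xbar_dom : edom f xbar) (r_gt0 : 0 < r) (l_ge0 : 0 <= l) :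
  (lipschitz_efun_on f l (edom f `&` ball xbar r) <->
     (forall x, (edom f `&` ball xbar r) x -> calm f x l)) /\
  ((forall x, (edom f `&` ball xbar r) x -> calm f x l) <->
     (forall x, (edom f `&` ball xbar r) x ->
        subdifferential f x `&` dual_ball l !=set0)).
Proof.
split; split.
- by move=> fl x; apply: lipschitz_calm => //; exact: ball_open.
- exact: calm_lipschitz.
- by move=> fc x /fc; exact: calm_subgradient.
- by move=> fs x /fs; exact: subgradient_calm.
Qed.
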